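(* Let $\mathbf{k}$ be a field of characteristic not $2$, let $q=-1$ be the primitive second root of unity in $\mathbf{k}$, and let $H_2^\imath(q)$ be the $\imath$Hopf algebra associated with the Taft algebra $H_2(q)$ of dimension $4$ and the self-duality $\varphi$ defined in the context. Then $H_2^\imath(q)$ is commutative, and it is isomorphic as an algebra to the group algebra $\mathbf{k}(\mathbb{Z}/4\mathbb{Z})$ if the base field $\mathbf{k}$ is algebraically closed.
   Context: The Taft algebra $H_2(q)$ is the $\mathbf{k}$-algebra generated by $g,h$ subject to $g^2=1$, $h^2=0$, $hg=qgh$ (with $q=-1$), with Hopf structure $\Delta(g)=g\otimes g$, $\Delta(h)=1\otimes h+h\otimes g$, $\varepsilon(g)=1$, $\varepsilon(h)=0$, antipode $g\mapsto g^{-1}=g$, $h\mapsto -q^{-1}gh$. It has basis $(d_1,d_2,d_3,d_4)=(1,g,h,gh)$. Let $(d_1^*,\dots,d_4^* )$ be the dual basis of the dual Hopf algebra $H_2(q)^*$ and let $\varphi:H_2(q)\to H_2(q)^*$ be the Hopf algebra isomorphism $\varphi(d_i)=\sum_j s_{ji}d_j^*$ with symmetric matrix $$(s_{ij})=\begin{pmatrix}1&1&0&0\\1&-1&0&0\\0&0&1&1\\0&0&1&-1\end{pmatrix}.$$ Write $d_i\cdot d_j=\sum_k\widetilde F_{ij}^k d_k$ and $\Delta(d_k)=\sum_{i,j}\widetilde G_{ij}^k\, d_i\otimes d_j$. The $\imath$Hopf algebra $H_2^\imath(q)$ is the vector space with basis $d_1,\dots,d_4$ and the bilinear multiplication $d_i\diamond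 d_j=\sum_k{}^\imath\widetilde F_{ij}^k d_k$, where ${}^\imath\widetilde F_{ij}^k=\sum_{y_1,y_2,x,z}s_{y_1y_2}\widetilde G_{y_1x}^{i}\widetilde G_{zy_2}^{j}\widetilde F_{xz}^{k}$; its unit is $d_1=1$. *)

(* Defs.v *)
From HB Require Import structures.
From mathcomp Require Import all_boot all_order all_algebra all_fingroup.
From mathcomp Require Import ring.

Set Implicit Arguments.
Unset Strict Implicit.
Unset Printing Implicit Defensive.

Import GRing.Theory.
Local Open Scope ring_scope.

Definition structure_mul (k : fieldType) n (c : 'I_n -> 'I_n -> 'I_n -> k)
    (x y : 'rV[k]_n) : 'rV[k]_n :=
  \row_l \sum_i \sum_j x 0 i * y 0 j * c i j l.

Section StructureMul.
Variables (k : fieldType) (n : nat) (c : 'I_n -> 'I_n -> 'I_n -> k).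
Local Notation m := (structure_mul c).

Lemma structure_mulDl : left_distributive m +%R.
Proof.
move=> x y z; apply/rowP=> l; rewrite !mxE -big_split; apply: eq_bigr => i _.
by rewrite -big_split; apply: eq_bigr => j _; rewrite mxE /= !mulrDl.
Qed.

Lemma structure_mulDr : right_distributive m +%R.
Proof.
move=> x y z; apply/rowP=> l; rewrite !mxE -big_split; apply: eq_bigr => i _.
by rewrite -big_split; apply: eq_bigr => j _; rewrite mxE /= mulrDr mulrDl.
Qed.

Lemma structure_mulAl a x y : a *: m x y = m (a *: x) y.
Proof.
apply/rowP=> l; rewrite !mxE mulr_sumr; apply: eq_bigr => i _.
by rewrite mulr_sumr; apply: eq_bigr => j _; rewrite mxE !mulrA.
Qed.

Lemma structure_mulAr a x y : a *: m x y = m x (a *: y).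
Proof.
apply/rowP=> l; rewrite !mxE mulr_sumr; apply: eq_bigr => i _.
by rewrite mulr_sumr; apply: eq_bigr => j _; rewrite mxE; ring.
Qed.

Lemma structure_mul_eval (B : algType k) (e : 'I_n -> B) :
    (forall i j, e i * e j = \sum_l c i j l *: e l) -> forall x y,
  \sum_l m x y 0 l *: e l = (\sum_i x 0 i *: e i) * (\sum_j y 0 j *: e j).
Proof.
move=> eM x y; under eq_bigr => l _ do rewrite mxE scaler_suml.
rewrite exchange_big mulr_suml /=; apply: eq_bigr => i _.
under eq_bigr => l _ do rewrite scaler_suml.
rewrite exchange_big mulr_sumr /=; apply: eq_bigr => j _.
rewrite -scalerAl -scalerAr eM !scaler_sumr; apply: eq_bigr => l _.
by rewrite !scalerA.
Qed.

End StructureMul.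

Notation o0 := (@Ordinal 4 0 isT).
Notation o1 := (@Ordinal 4 1 isT).
Notation o2 := (@Ordinal 4 2 isT).
Notation o3 := (@Ordinal 4 3 isT).

Lemma sum4 (V : nmodType) (F : 'I_4 -> V) :
  \sum_i F i = F o0 + F o1 + F o2 + F o3.
Proof.
rewrite !big_ord_recl big_ord0 addr0 !addrA.
by do ![congr (_ + _)]; congr F; apply: val_inj.
Qed.

Lemma ord4P (P : 'I_4 -> Prop) : P o0 -> P o1 -> P o2 -> P o3 -> forall i, P i.
Proof.
by move=> P0 P1 P2 P3; case=> [[|[|[|[|//]]]] lt_i];
   rewrite (bool_irrelevance lt_i isT).
Qed.

(* The basis vector d_i is g^a h^b with a = i %% 2 and b = i %/ 2, and          *)
(* (g^a h^b) (g^c h^d) = q^(b c) g^(a + c) h^(b + d), where q = -1, g^2 = 1 and *)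
(* h^2 = 0.                                                                     *)
Definition taft_str (k : fieldType) (i j l : 'I_4) : k :=
  if (i %/ 2 + j %/ 2 < 2)%N then
    let q : k := -1 in q ^+ (i %/ 2 * (j %% 2))%N
      *+ (l == ((i %% 2 + j %% 2) %% 2 + 2 * (i %/ 2 + j %/ 2))%N :> nat)
  else 0.

Definition taft (k : fieldType) : Type := 'rV[k]_4.

HB.instance Definition _ (k : fieldType) := Vector.copy (taft k) 'rV[k]_4.

Definition taft_d (k : fieldType) (i : 'I_4) : taft k := delta_mx 0 i.

Section TaftAlgebra.
Variable k : fieldType.
Local Notation m := (@structure_mul k 4 (@taft_str k)).

Lemma taft_mulE (x y : 'rV[k]_4) :
  [/\ m x y 0 o0 = x 0 o0 * y 0 o0 + x 0 o1 * y 0 o1,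
      m x y 0 o1 = x 0 o0 * y 0 o1 + x 0 o1 * y 0 o0,
      m x y 0 o2 = x 0 o0 * y 0 o2 + x 0 o1 * y 0 o3
                 + x 0 o2 * y 0 o0 - x 0 o3 * y 0 o1 &
      m x y 0 o3 = x 0 o0 * y 0 o3 + x 0 o1 * y 0 o2
                 - x 0 o2 * y 0 o1 + x 0 o3 * y 0 o0].
Proof.
by split; rewrite mxE !sum4 /taft_str /=
  ?(mulr0n, mulr1n, expr0, expr1, mulr0, mulr1, addr0, add0r); ring.
Qed.

Lemma taft_mulA : associative m.
Proof.
move=> x y z; have [xy0 xy1 xy2 xy3] := taft_mulE x y.
have [yz0 yz1 yz2 yz3] := taft_mulE y z.
have [a0 a1 a2 a3] := taft_mulE x (m y z).
have [b0 b1 b2 b3] := taft_mulE (m x y) z.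
apply/rowP; apply: ord4P; rewrite ?(a0, a1, a2, a3, b0, b1, b2, b3)
  ?(xy0, xy1, xy2, xy3, yz0, yz1, yz2, yz3); ring.
Qed.

Lemma taft_mul1 : left_id (taft_d k o0 : 'rV_4) m.
Proof.
move=> x; have [a0 a1 a2 a3] := taft_mulE (taft_d k o0) x.
by apply/rowP; apply: ord4P; rewrite ?(a0, a1, a2, a3) !mxE /=; ring.
Qed.

Lemma taft_mulr1 : right_id (taft_d k o0 : 'rV_4) m.
Proof.
move=> x; have [a0 a1 a2 a3] := taft_mulE x (taft_d k o0).
by apply/rowP; apply: ord4P; rewrite ?(a0, a1, a2, a3) !mxE /=; ring.
Qed.

Lemma taft_d_neq0 i : taft_d k i != 0.
Proof.
by apply/eqP => /rowP/(_ i); rewrite !mxE !eqxx; apply/eqP/oner_neq0.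
Qed.

HB.instance Definition _ := GRing.Zmodule_isNzRing.Build (taft k)
  taft_mulA taft_mul1 taft_mulr1 (structure_mulDl (@taft_str k))
  (structure_mulDr (@taft_str k)) (taft_d_neq0 o0).
HB.instance Definition _ := GRing.Lmodule_isLalgebra.Build k (taft k)
  (structure_mulAl (@taft_str k)).
HB.instance Definition _ := GRing.Lalgebra_isAlgebra.Build k (taft k)
  (structure_mulAr (@taft_str k)).

End TaftAlgebra.

Notation taft_g k := (taft_d k o1).
Notation taft_h k := (taft_d k o2).

Definition taft_coord (k : fieldType) (x : taft k) (i : 'I_4) : k :=
  (x : 'rV_4) 0 i.

Section TaftPresentation.
Variable k : fieldType.
Local Notation g := (taft_g k).
Local Notation h := (taft_h k).

Lemma taft_coordP (x y : taft k) :
  (forall i, taft_coord x i = taft_coord y i) -> x = y.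
Proof. by move=> xy; apply/rowP. Qed.

Lemma taft_coord_d i j : taft_coord (taft_d k i) j = (i == j)%:R.
Proof. by rewrite /taft_coord !mxE eqxx eq_sym. Qed.

Lemma taft_basis (x : taft k) : x = \sum_i taft_coord x i *: taft_d k i.
Proof. exact: row_sum_delta. Qed.

Lemma taft_dM i j l :
  taft_coord (taft_d k i * taft_d k j) l = taft_str k i j l.
Proof.
rewrite /taft_coord mxE (bigD1 i) //= (bigD1 j) //= !mxE !eqxx !mul1r.
rewrite !big1 ?addr0 // => [i' /negPf ii'|j' /negPf jj'].
  by rewrite big1 // => j' _; rewrite !mxE ii' andbF !mul0r.
by rewrite !mxE jj' andbF mulr0 mul0r.
Qed.

Lemma taft_d0 : taft_d k o0 = 1. Proof. by []. Qed.

Lemma taft_d3 : taft_d k o3 = g * h.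
Proof.
by apply: taft_coordP => l; rewrite taft_dM taft_coord_d; move: l; apply: ord4P.
Qed.

Lemma taft_gg : g * g = 1.
Proof.
rewrite -taft_d0; apply: taft_coordP => l; rewrite taft_dM taft_coord_d.
by move: l; apply: ord4P.
Qed.

Lemma taft_hh : h * h = 0.
Proof.
by apply: taft_coordP => l; rewrite taft_dM [RHS]mxE; move: l; apply: ord4P.
Qed.

Lemma taft_hg : h * g = - (g * h).
Proof.
rewrite -taft_d3; apply: taft_coordP => l.
rewrite taft_dM [RHS]mxE -/(taft_coord _ _) taft_coord_d; move: l.
by apply: ord4P; rewrite /taft_str /= ?oppr0.
Qed.

(* k<g, h> / (g^2 = 1, h^2 = 0, h g = q g h): the relations hold above, and *)
(* taft k is universal for them.                                            *)
Lemma taft_universal (B : algType k) (a b : B) :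
  a * a = 1 -> b * b = 0 -> b * a = - (a * b) ->
  exists f : {lrmorphism taft k -> B}, [/\ f g = a, f h = b &
    forall f' : {lrmorphism taft k -> B}, f' g = a -> f' h = b -> f' =1 f].
Proof.
move=> aa bb ba; pose e (i : 'I_4) := a ^+ (i %% 2) * b ^+ (i %/ 2).
have e0 : e o0 = 1 by rewrite /e mulr1.
have e1 : e o1 = a by rewrite /e /= mulr1.
have e2 : e o2 = b by rewrite /e /= mul1r.
have e3 : e o3 = a * b by [].
have eM i j : e i * e j = \sum_l taft_str k i j l *: e l.
  move: i j; apply: ord4P; apply: ord4P; rewrite sum4 ?e0 ?e1 ?e2 ?e3;
    rewrite /taft_str /= ?(mulr0n, mulr1n, expr0, expr1, scale0r, scale1r,
      scaleN1r, addr0, add0r) ?(mul1r, mulr1) //.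
  - by rewrite mulrA aa mul1r.
  - by rewrite mulrA ba mulNr -mulrA bb mulr0 oppr0.
  - by rewrite -mulrA ba mulrN mulrA aa mul1r.
  - by rewrite -mulrA bb mulr0.
  - by rewrite -mulrA [b * _]mulrA ba mulNr -mulrA bb !mulr0 oppr0 mulr0.
pose f (x : taft k) := \sum_i taft_coord x i *: e i.
have fL : linear f.
  move=> u x y; rewrite /f scaler_sumr -big_split; apply: eq_bigr => i _.
  by rewrite /taft_coord !mxE scalerDl scalerA.
have fd i : f (taft_d k i) = e i.
  rewrite /f (bigD1 i) //= big1 ?addr0 => [|j /negPf ij].
    by rewrite taft_coord_d eqxx scale1r.
  by rewrite taft_coord_d eq_sym ij scale0r.
have fM : monoid_morphism f.
  split=> [|x y]; first by rewrite -taft_d0 fd.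
  exact: structure_mul_eval.
pose aL := GRing.isLinear.Build k _ _ _ f fL.
pose aM := GRing.isMonoidMorphism.Build _ _ f fM.
pose fF : {lrmorphism taft k -> B} := HB.pack f aL aM.
exists fF; split=> [||f' f'g f'h x]; rewrite /= ?fd //.
rewrite [in LHS](taft_basis x) linear_sum; apply: eq_bigr => i _.
rewrite linearZ /=; congr (_ *: _); move: i; apply: ord4P.
- by rewrite e0 -(rmorph1 f').
- by rewrite e1.
- by rewrite e2.
- by rewrite e3 taft_d3 rmorphM /= f'g f'h.
Qed.

End TaftPresentation.

(* An element of H (x) H is the matrix of its coordinates on d_i (x) d_j. *)
Definition taft2 (k : fieldType) : Type := 'M[k]_4.

HB.instance Definition _ (k : fieldType) := Vector.copy (taft2 k) 'M[k]_4.

Definition tens (k : fieldType) (x y : taft k) : taft2 k :=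
  (x : 'rV_4)^T *m (y : 'rV_4).

(* (a (x) b) (c (x) d) = (a c) (x) (b d) *)
Definition tens_mul (k : fieldType) (X Y : taft2 k) : taft2 k :=
  \sum_i \sum_j \sum_i' \sum_j'
    ((X : 'M_4) i j * (Y : 'M_4) i' j') *:
      tens (taft_d k i * taft_d k i') (taft_d k j * taft_d k j').

Definition comult_g (k : fieldType) : taft2 k := tens (taft_g k) (taft_g k).

Definition comult_h (k : fieldType) : taft2 k :=
  tens 1 (taft_h k) + tens (taft_h k) (taft_g k).

Definition comult_d (k : fieldType) (i : 'I_4) : taft2 k :=
  match val i with
  | 0%N => tens 1 1
  | 1%N => comult_g k
  | 2%N => comult_h k
  | _ => tens_mul (comult_g k) (comult_h k)
  end.

Definition comult (k : fieldType) (x : taft k) : taft2 k :=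
  \sum_i taft_coord x i *: comult_d k i.

Definition counit (k : fieldType) (x : taft k) : k :=
  taft_coord x o0 + taft_coord x o1.

Definition selfdual_mx (k : fieldType) : 'M[k]_4 :=
  \matrix_(i, j)
    match val i, val j with
    | 0%N, (0%N | 1%N) | 1%N, 0%N | 2%N, (2%N | 3%N) | 3%N, 2%N => 1
    | 1%N, 1%N | 3%N, 3%N => -1
    | _, _ => 0
    end.

(* phi (d_i) = \sum_j s_(j i) d_j^*, evaluated at y *)
Definition selfdual (k : fieldType) (x y : taft k) : k :=
  \sum_i \sum_j taft_coord x i * selfdual_mx k j i * taft_coord y j.

Section TaftCoproduct.
Variable k : fieldType.
Implicit Types x y z t : taft k.
Local Notation g := (taft_g k).
Local Notation h := (taft_h k).
Local Notation d := (taft_d k).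

Lemma tensE x y i j : (tens x y : 'M_4) i j = taft_coord x i * taft_coord y j.
Proof. by rewrite mxE big_ord1 mxE. Qed.

Lemma tens_is_linear x : linear (tens x).
Proof.
by move=> a y z; exact: (linearP (mulmx (x : 'rV_4)^T) a (y : 'rV_4) (z : 'rV_4)).
Qed.

HB.instance Definition _ x :=
  GRing.isLinear.Build k (taft k) (taft2 k) _ (tens x) (@tens_is_linear x).

Lemma tens_is_linear_l z : linear (fun x => tens x z).
Proof.
move=> a x y; have /= := linearP (mulmxr (z : 'rV_4)) a (x : 'rV_4)^T (y : 'rV_4)^T.
by move <-; rewrite -linearP.
Qed.

Lemma tensDl x y z : tens (x + y) z = tens x z + tens y z.
Proof. by have := tens_is_linear_l z 1 x y; rewrite !scale1r. Qed.

Lemma tens0l z : tens 0 z = 0.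
Proof.
by have := tens_is_linear_l z 1 0 0; rewrite !scale1r addr0 -{1}[tens 0 z]addr0 => /addrI.
Qed.

Lemma tensZl a x z : tens (a *: x) z = a *: tens x z.
Proof. by have := tens_is_linear_l z a x 0; rewrite tens0l !addr0. Qed.

Lemma tensNl x z : tens (- x) z = - tens x z.
Proof. by rewrite -scaleN1r tensZl scaleN1r. Qed.

Lemma tens_suml n (F : 'I_n -> taft k) z :
  tens (\sum_i F i) z = \sum_i tens (F i) z.
Proof.
have tD : {morph (fun x => tens x z) : u v / u + v} by move=> u v; rewrite tensDl.
exact: (big_morph (fun x => tens x z) tD (tens0l z)).
Qed.

Lemma tens_mulDl X Y Z : tens_mul (X + Y) Z = tens_mul X Z + tens_mul Y Z :> taft2 k.
Proof.
do 4![rewrite -big_split; apply: eq_bigr => ? _].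
by rewrite mxE mulrDl scalerDl.
Qed.

Lemma tens_mulDr X Y Z : tens_mul X (Y + Z) = tens_mul X Y + tens_mul X Z :> taft2 k.
Proof.
do 4![rewrite -big_split; apply: eq_bigr => ? _].
by rewrite mxE mulrDr scalerDl.
Qed.

Lemma tens_mulZl a X Y : tens_mul (a *: X) Y = a *: tens_mul X Y :> taft2 k.
Proof.
do 4![rewrite scaler_sumr; apply: eq_bigr => ? _].
by rewrite mxE scalerA mulrA.
Qed.

Lemma tens_mulZr a X Y : tens_mul X (a *: Y) = a *: tens_mul X Y :> taft2 k.
Proof.
do 4![rewrite scaler_sumr; apply: eq_bigr => ? _].
by rewrite mxE scalerA mulrCA.
Qed.

Lemma tens_mul_tens x y z t :
  tens_mul (tens x y) (tens z t) = tens (x * z) (y * t).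
Proof.
rewrite {2}(taft_basis x) mulr_suml tens_suml; apply: eq_bigr => i _.
rewrite {2}(taft_basis y) mulr_suml linear_sum /=; apply: eq_bigr => j _.
rewrite {2}(taft_basis z) mulr_sumr tens_suml; apply: eq_bigr => i' _.
rewrite {2}(taft_basis t) mulr_sumr linear_sum /=; apply: eq_bigr => j' _.
rewrite !tensE -!scalerAl -!scalerAr !linearZ /= !tensZl !scalerA.
by congr (_ *: _); ring.
Qed.

Lemma comult_d3 : comult_d k o3 = tens g (d o3) + tens (d o3) 1.
Proof.
by rewrite /comult_d /= tens_mulDr !tens_mul_tens mulr1 -taft_d3 taft_gg.
Qed.

Lemma comultE_d i : comult (d i) = comult_d k i.
Proof.
rewrite /comult (bigD1 i) //= big1 ?addr0 => [|j /negPf ij].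
  by rewrite taft_coord_d eqxx scale1r.
by rewrite taft_coord_d eq_sym ij scale0r.
Qed.

Lemma comult_is_linear : linear (@comult k).
Proof.
move=> u x y; rewrite /comult scaler_sumr -big_split; apply: eq_bigr => i _.
by rewrite /taft_coord !mxE scalerDl scalerA.
Qed.

HB.instance Definition _ :=
  GRing.isLinear.Build k (taft k) (taft2 k) _ (@comult k) comult_is_linear.

Lemma comult1 : comult 1 = tens 1 1 :> taft2 k.
Proof. by rewrite -taft_d0 comultE_d. Qed.

Lemma comultM x y : comult (x * y) = tens_mul (comult x) (comult y).
Proof.
have g_gh : g * d o3 = h by rewrite taft_d3 mulrA taft_gg mul1r.
have gh_g : d o3 * g = - h by rewrite taft_d3 -mulrA taft_hg mulrN mulrA taft_gg mul1r.
have h_gh : h * d o3 = 0 by rewrite taft_d3 mulrA taft_hg mulNr -mulrA taft_hh mulr0 oppr0.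
have gh_h : d o3 * h = 0 by rewrite taft_d3 -mulrA taft_hh mulr0.
have gh_gh : d o3 * d o3 = 0 by rewrite {1}taft_d3 -mulrA h_gh mulr0.
have H i j : comult (d i * d j) = tens_mul (comult (d i)) (comult (d j)).
  have c1 : comult_d k o0 = tens 1 1 by [].
  have cg : comult_d k o1 = tens g g by [].
  have ch : comult_d k o2 = tens 1 h + tens h g by [].
  pose dE := (taft_gg, taft_hh, taft_hg, g_gh, gh_g, h_gh, gh_h, gh_gh).
  move: i j; apply: ord4P; apply: ord4P; rewrite ?taft_d0 ?(mul1r, mulr1) ?dE
    -?taft_d3 ?linearN ?linear0 ?comult1 ?comultE_d ?c1 ?cg ?ch ?comult_d3
    ?(tens_mulDl, tens_mulDr) ?tens_mul_tens ?(mul1r, mulr1) ?dE -?taft_d3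
    ?(tensNl, linearN, linear0, tens0l, opprK, addr0, add0r, mul1r, mulr1) //=.
  - by rewrite comultE_d comult_d3 opprD.
  - by rewrite addNr.
  - by rewrite subrr.
  - by rewrite comultE_d ch opprD.
  - by rewrite addNr.
  - by rewrite subrr.
pose D : {linear taft k -> taft2 k} := @comult k.
suff: D (x * y) = tens_mul (D x) (D y) by [].
have tens_mul_suml (F : 'I_4 -> taft2 k) Y :
    tens_mul (\sum_i F i) Y = \sum_i tens_mul (F i) Y.
  by rewrite !sum4 !tens_mulDl.
have tens_mul_sumr (F : 'I_4 -> taft2 k) X :
    tens_mul X (\sum_i F i) = \sum_i tens_mul X (F i).
  by rewrite !sum4 !tens_mulDr.
rewrite (taft_basis x) mulr_suml !linear_sum tens_mul_suml.
apply: eq_bigr => i _; rewrite (taft_basis y) mulr_sumr !linear_sum tens_mul_sumr.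
apply: eq_bigr => j _; rewrite -scalerAl -scalerAr !linearZ /=.
by rewrite tens_mulZl tens_mulZr H.
Qed.

Lemma comult_sum (R : taft k) (f : 'I_4 -> 'I_4 -> k) :
  \sum_i \sum_j (comult R : 'M_4) i j * f i j =
  taft_coord R o0 * f o0 o0 + taft_coord R o1 * f o1 o1
  + taft_coord R o2 * (f o0 o2 + f o2 o1)
  + taft_coord R o3 * (f o1 o3 + f o3 o0).
Proof.
pose S (X : taft2 k) := \sum_i \sum_j (X : 'M_4) i j * f i j.
have SD X Y : S (X + Y) = S X + S Y.
  by do 2![rewrite -big_split; apply: eq_bigr => ? _]; rewrite mxE mulrDl.
have SZ a X : S (a *: X) = a * S X.
  by do 2![rewrite mulr_sumr; apply: eq_bigr => ? _]; rewrite mxE mulrA.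
have ST a b : S (tens (d a) (d b)) = f a b.
  rewrite /S (bigD1 a) //= (bigD1 b) //= tensE !taft_coord_d !eqxx !mul1r.
  rewrite !big1 ?addr0 // => [i /negPf ai|j /negPf bj]; last first.
    by rewrite tensE !taft_coord_d [b == j]eq_sym bj mulr0 mul0r.
  by rewrite big1 // => j _; rewrite tensE !taft_coord_d eq_sym ai !mul0r.
rewrite -/(S _) /comult sum4 !SD !SZ comult_d3 /comult_d /=.
by rewrite /comult_g /comult_h -taft_d0 !SD !ST.
Qed.

Lemma counit1 : counit (1 : taft k) = 1.
Proof. by rewrite /counit -taft_d0 !taft_coord_d addr0. Qed.

Lemma taft_coordM x y :
  [/\ taft_coord (x * y) o0 = taft_coord x o0 * taft_coord y o0
                           + taft_coord x o1 * taft_coord y o1,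
      taft_coord (x * y) o1 = taft_coord x o0 * taft_coord y o1
                           + taft_coord x o1 * taft_coord y o0,
      taft_coord (x * y) o2 = taft_coord x o0 * taft_coord y o2
                           + taft_coord x o1 * taft_coord y o3
                           + taft_coord x o2 * taft_coord y o0
                           - taft_coord x o3 * taft_coord y o1 &
      taft_coord (x * y) o3 = taft_coord x o0 * taft_coord y o3
                           + taft_coord x o1 * taft_coord y o2
                           - taft_coord x o2 * taft_coord y o1
                           + taft_coord x o3 * taft_coord y o0].
Proof. exact: taft_mulE. Qed.

Lemma counitM x y : counit (x * y) = counit x * counit y.
Proof. by rewrite /counit; have [-> -> _ _] := taft_coordM x y; ring. Qed.

Lemma counit_comult x i :
  \sum_j counit (d j) * (comult x : 'M_4) j i = taft_coord x i /\
  \sum_j (comult x : 'M_4) i j * counit (d j) = taft_coord x i.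
Proof.
have cL (f : 'I_4 -> k) j : \sum_i f i * (i == j)%:R = f j.
  rewrite (bigD1 j) //= eqxx mulr1 big1 ?addr0 // => j' /negPf ->.
  by rewrite mulr0.
split.
  transitivity (\sum_j \sum_l (comult x : 'M_4) j l * (counit (d j) * (l == i)%:R)).
    apply: eq_bigr => j _; rewrite -(cL (fun l => counit (d j) * (comult x : 'M_4) j l)).
    by apply: eq_bigr => l _; ring.
  rewrite comult_sum /counit !taft_coord_d /=; move: i.
  by apply: ord4P; rewrite /=; ring.
transitivity (\sum_l \sum_j (comult x : 'M_4) l j * (counit (d j) * (l == i)%:R)).
  rewrite -(cL (fun l => \sum_j (comult x : 'M_4) l j * counit (d j))).
  by apply: eq_bigr => l _; rewrite mulr_suml; apply: eq_bigr => j _; ring.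
rewrite comult_sum /counit !taft_coord_d /=; move: i.
by apply: ord4P; rewrite /=; ring.
Qed.

Lemma selfdualE x y : selfdual x y =
  taft_coord x o0 * (taft_coord y o0 + taft_coord y o1)
  + taft_coord x o1 * (taft_coord y o0 - taft_coord y o1)
  + taft_coord x o2 * (taft_coord y o2 + taft_coord y o3)
  + taft_coord x o3 * (taft_coord y o2 - taft_coord y o3).
Proof. by rewrite /selfdual !sum4 !mxE /=; ring. Qed.

(* selfdual is a morphism of algebras and of coalgebras to the dual of H *)
Lemma selfdualM x y z : selfdual (x * y) z =
  \sum_i \sum_j (comult z : 'M_4) i j * (selfdual x (d i) * selfdual y (d j)).
Proof.
rewrite comult_sum !selfdualE; have [-> -> -> ->] := taft_coordM x y.
by rewrite !taft_coord_d /=; ring.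
Qed.

Lemma selfdual1 z : selfdual 1 z = counit z.
Proof. by rewrite selfdualE -taft_d0 !taft_coord_d /counit /=; ring. Qed.

Lemma selfdual_comult x y z : selfdual x (y * z) =
  \sum_i \sum_j (comult x : 'M_4) i j * (selfdual (d i) y * selfdual (d j) z).
Proof.
rewrite comult_sum !selfdualE; have [-> -> -> ->] := taft_coordM y z.
by rewrite !taft_coord_d /=; ring.
Qed.

Lemma selfdual_counit x : selfdual x 1 = counit x.
Proof. by rewrite selfdualE -taft_d0 !taft_coord_d /counit /=; ring. Qed.

Lemma selfdual_mx_unit : 2%N \notin [pchar k] -> selfdual_mx k \in unitmx.
Proof.
rewrite inE /= => n2; have: (2%:R : k)^-1 *: selfdual_mx k *m selfdual_mx k = 1%:M.
  apply/matrixP=> i j; rewrite !mxE sum4 !mxE.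
  by move: i j; apply: ord4P; apply: ord4P; rewrite /=; field.
by case/mulmx1_unit.
Qed.

End TaftCoproduct.

Definition taft_F (k : fieldType) (i j l : 'I_4) : k :=
  taft_coord (taft_d k i * taft_d k j) l.

Definition taft_G (k : fieldType) (i j l : 'I_4) : k :=
  (comult (taft_d k l) : 'M_4) i j.

Definition ihopf_F (k : fieldType) (i j l : 'I_4) : k :=
  \sum_y1 \sum_y2 \sum_x \sum_z
    selfdual_mx k y1 y2 * taft_G k y1 x i * taft_G k z y2 j * taft_F k x z l.

Definition ihopf (k : fieldType) : Type := 'rV[k]_4.

HB.instance Definition _ (k : fieldType) := Vector.copy (ihopf k) 'rV[k]_4.

Definition ihopf_d (k : fieldType) (i : 'I_4) : ihopf k := delta_mx 0 i.

Section IHopfAlgebra.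
Variable k : fieldType.
Local Notation m := (@structure_mul k 4 (@ihopf_F k)).

Lemma ihopf_FE i j l : ihopf_F k i j l =
  \sum_y1 \sum_x taft_G k y1 x i *
    \sum_z \sum_y2 taft_G k z y2 j * (selfdual_mx k y1 y2 * taft_F k x z l).
Proof.
apply: eq_bigr => y1 _; rewrite exchange_big; apply: eq_bigr => x _.
rewrite exchange_big mulr_sumr; apply: eq_bigr => z _.
by rewrite mulr_sumr; apply: eq_bigr => y2 _; ring.
Qed.

Definition ihopf_table (i j l : nat) : k :=
  match i, j, l with
  | 0, 0, 0 | 0, 1, 1 | 0, 2, 2 | 0, 3, 3 | 1, 0, 1 | 2, 0, 2 | 3, 0, 3
  | 2, 2, 1 | 1, 3, 2 | 3, 1, 2 | 2, 3, 0 | 3, 2, 0 => 1%R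
  | 1, 1, 0 | 1, 2, 3 | 2, 1, 3 | 3, 3, 1 => (-1)%R
  | _, _, _ => 0%R
  end%N.

Lemma ihopf_F_table i j l : ihopf_F k i j l = ihopf_table i j l.
Proof.
have s0 := (mul0r, mul1r, mulr0, mulr1, addr0, add0r).
rewrite ihopf_FE /taft_G; move: i j l.
apply: ord4P; apply: ord4P => l; rewrite comult_sum !taft_coord_d /= ?s0;
  rewrite !comult_sum !taft_coord_d /= ?s0 !mxE /= ?s0 /taft_F ?taft_dM;
  move: l; apply: ord4P; rewrite /taft_str /ihopf_table /=;
  by rewrite ?expr0 ?expr1 ?(mulr0n, mulr1n) ?s0 ?mulN1r ?opprK ?oppr0 ?s0.
Qed.

Lemma ihopf_mulE (x y : 'rV[k]_4) :
  [/\ m x y 0 o0 = x 0 o0 * y 0 o0 - x 0 o1 * y 0 o1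
                 + x 0 o2 * y 0 o3 + x 0 o3 * y 0 o2,
      m x y 0 o1 = x 0 o0 * y 0 o1 + x 0 o1 * y 0 o0
                 + x 0 o2 * y 0 o2 - x 0 o3 * y 0 o3,
      m x y 0 o2 = x 0 o0 * y 0 o2 + x 0 o2 * y 0 o0
                 + x 0 o1 * y 0 o3 + x 0 o3 * y 0 o1 &
      m x y 0 o3 = x 0 o0 * y 0 o3 + x 0 o3 * y 0 o0
                 - x 0 o1 * y 0 o2 - x 0 o2 * y 0 o1].
Proof.
by split; rewrite mxE !sum4 !ihopf_F_table /=
  ?(mulr0, mulr1, addr0, add0r); ring.
Qed.

Lemma ihopf_mulA : associative m.
Proof.
move=> x y z; have [xy0 xy1 xy2 xy3] := ihopf_mulE x y.
have [yz0 yz1 yz2 yz3] := ihopf_mulE y z.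
have [a0 a1 a2 a3] := ihopf_mulE x (m y z).
have [b0 b1 b2 b3] := ihopf_mulE (m x y) z.
apply/rowP; apply: ord4P; rewrite ?(a0, a1, a2, a3, b0, b1, b2, b3)
  ?(xy0, xy1, xy2, xy3, yz0, yz1, yz2, yz3); ring.
Qed.

Lemma ihopf_mul1 : left_id (ihopf_d k o0 : 'rV_4) m.
Proof.
move=> x; have [a0 a1 a2 a3] := ihopf_mulE (ihopf_d k o0) x.
by apply/rowP; apply: ord4P; rewrite ?(a0, a1, a2, a3) !mxE /=; ring.
Qed.

Lemma ihopf_mulr1 : right_id (ihopf_d k o0 : 'rV_4) m.
Proof.
move=> x; have [a0 a1 a2 a3] := ihopf_mulE x (ihopf_d k o0).
by apply/rowP; apply: ord4P; rewrite ?(a0, a1, a2, a3) !mxE /=; ring.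
Qed.

HB.instance Definition _ := GRing.Zmodule_isNzRing.Build (ihopf k)
  ihopf_mulA ihopf_mul1 ihopf_mulr1 (structure_mulDl (@ihopf_F k))
  (structure_mulDr (@ihopf_F k)) (taft_d_neq0 k o0).
HB.instance Definition _ := GRing.Lmodule_isLalgebra.Build k (ihopf k)
  (structure_mulAl (@ihopf_F k)).
HB.instance Definition _ := GRing.Lalgebra_isAlgebra.Build k (ihopf k)
  (structure_mulAr (@ihopf_F k)).

End IHopfAlgebra.

Definition group_algebra (k : fieldType) (gT : finGroupType) : Type :=
  {ffun gT -> k^o}.

HB.instance Definition _ (k : fieldType) (gT : finGroupType) :=
  Vector.copy (group_algebra k gT) {ffun gT -> k^o}.

Section GroupAlgebra.
Variables (k : fieldType) (gT : finGroupType).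
Implicit Types u v w : {ffun gT -> k^o}.

(* \sum_x u_x x is encoded as the function u. *)
Definition galg_mul u v : {ffun gT -> k^o} :=
  [ffun z => \sum_x u x * v (x^-1 * z)%g].

Definition galg_of (x : gT) : {ffun gT -> k^o} := [ffun z => (z == x)%:R].

Lemma galg_ofM x y : galg_mul (galg_of x) (galg_of y) = galg_of (x * y)%g.
Proof.
apply/ffunP=> z; rewrite !ffunE (bigD1 x) //= big1 => [|x' /negPf xx'].
  by rewrite !ffunE eqxx mul1r addr0 -(inj_eq (mulgI x)) mulKVg.
by rewrite !ffunE xx' mul0r.
Qed.

Lemma galg_mulA : associative galg_mul.
Proof.
move=> u v w; apply/ffunP=> z; rewrite !ffunE.
transitivity (\sum_x \sum_y u x * v (x^-1 * y)%g * w (y^-1 * z)%g).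
  apply: eq_bigr => x _; rewrite ffunE mulr_sumr (reindex_inj (mulgI x^-1%g)) /=.
  by apply: eq_bigr => y _; rewrite invMg invgK mulrA -!mulgA mulKVg.
rewrite exchange_big; apply: eq_bigr => y _.
by rewrite ffunE mulr_suml.
Qed.

Lemma galg_mul1 : left_id (galg_of 1) galg_mul.
Proof.
move=> u; apply/ffunP=> z; rewrite !ffunE (bigD1 1%g) //= ffunE eqxx mul1r.
rewrite invg1 mul1g big1 ?addr0 // => x /negPf x1.
by rewrite ffunE x1 mul0r.
Qed.

Lemma galg_mulr1 : right_id (galg_of 1) galg_mul.
Proof.
move=> u; apply/ffunP=> z; rewrite !ffunE (bigD1 z) //= ffunE mulVg eqxx mulr1.
rewrite big1 ?addr0 // => x /negPf xz.
by rewrite ffunE -eq_mulVg1 xz mulr0.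
Qed.

Lemma galg_mulDl : left_distributive galg_mul +%R.
Proof.
move=> u v w; apply/ffunP=> z; rewrite !ffunE -big_split.
by apply: eq_bigr => x _; rewrite ffunE mulrDl.
Qed.

Lemma galg_mulDr : right_distributive galg_mul +%R.
Proof.
move=> u v w; apply/ffunP=> z; rewrite !ffunE -big_split.
by apply: eq_bigr => x _; rewrite ffunE mulrDr.
Qed.

Lemma galg_1_neq0 : galg_of 1 != 0.
Proof.
by apply/eqP=> /ffunP/(_ 1%g); rewrite !ffunE eqxx; apply/eqP/oner_neq0.
Qed.

Lemma galg_mulAl (a : k) u v : a *: galg_mul u v = galg_mul (a *: u) v.
Proof.
apply/ffunP=> z; rewrite !ffunE scaler_sumr.
by apply: eq_bigr => x _; rewrite ffunE -scalerAl.
Qed.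

Lemma galg_mulAr (a : k) u v : a *: galg_mul u v = galg_mul u (a *: v).
Proof.
apply/ffunP=> z; rewrite !ffunE scaler_sumr.
by apply: eq_bigr => x _; rewrite ffunE -scalerAr.
Qed.

HB.instance Definition _ := GRing.Zmodule_isNzRing.Build (group_algebra k gT)
  galg_mulA galg_mul1 galg_mulr1 galg_mulDl galg_mulDr galg_1_neq0.
HB.instance Definition _ := GRing.Lmodule_isLalgebra.Build k
  (group_algebra k gT) galg_mulAl.
HB.instance Definition _ := GRing.Lalgebra_isAlgebra.Build k
  (group_algebra k gT) galg_mulAr.

End GroupAlgebra.

(* Main.v *)
Require Import Defs.
From HB Require Import structures.
From mathcomp Require Import all_boot all_order all_algebra all_fingroup.
From mathcomp Require Import ring.
Import GRing.Theory.
Local Open Scope ring_scope.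

(** In the basis d_1 = 1, d_2 = g, d_3 = h, d_4 = gh, the table of the product
    reads h^2 = g, h^3 = - gh and h^4 = - 1, so the algebra is k[X]/(X^4 + 1)
    with X = h. If zeta^4 = - 1, then X = zeta t identifies it with
    k[t]/(t^4 - 1), the group algebra of Z/4. *)

(** Each coordinate of the product is a symmetric bilinear form. *)
Lemma ihopf_mulC (k : fieldType) : commutative (@GRing.mul (ihopf k)).
Proof.
move=> x y; have [a0 a1 a2 a3] := ihopf_mulE x y.
have [b0 b1 b2 b3] := ihopf_mulE y x.
apply/rowP; apply: ord4P; rewrite ?(a0, a1, a2, a3) ?(b0, b1, b2, b3); ring.
Qed.

(** The images of 1, g, h, gh forced by sending h to [a], since g = h^2 and gh = - h^3. *)
Definition ihopf_powers {k : fieldType} {B : algType k} (a : B) (i : 'I_4) : B :=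
  match val i with
  | 0%N => 1
  | 1%N => a ^+ 2
  | 2%N => a
  | _ => - a ^+ 3
  end.

(** Universal property of k[X]/(X^4 + 1). *)
Lemma ihopf_lift {k : fieldType} {B : algType k} (a : B) : a ^+ 4 = -1 ->
  exists f : {lrmorphism ihopf k -> B},
    forall x, f x = \sum_i (x : 'rV_4) 0 i *: ihopf_powers a i.
Proof.
move=> a4; pose e := ihopf_powers a.
have a5 : a ^+ 5 = - a by rewrite exprS a4 mulrN1.
have a6 : a ^+ 6 = - a ^+ 2 by rewrite (exprD a 2 4) a4 mulrN1.
(* Exponents in these products are at most 6, so [a4], [a5] and [a6] reduce them all. *)
have eM i j : e i * e j = \sum_l ihopf_F k i j l *: e l.
  rewrite sum4 !ihopf_F_table; move: i j.
  apply: ord4P; apply: ord4P; rewrite /e /ihopf_powers /=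
    ?(scale0r, scale1r, scaleN1r, addr0, add0r) ?(mulrN, mulNr, opprK)
    ?(mul1r, mulr1) -?exprD -?exprS -?exprSr ?a4 ?a5 ?a6 ?opprK //.
pose f (x : ihopf k) := \sum_i (x : 'rV_4) 0 i *: e i.
have fL : linear f.
  move=> u x y; rewrite /f scaler_sumr -big_split; apply: eq_bigr => i _.
  by rewrite !mxE scalerDl scalerA.
have fM : monoid_morphism f.
  split=> [|x y]; last exact: structure_mul_eval.
  by rewrite /f sum4 !mxE /= !scale0r scale1r !addr0.
pose aL := GRing.isLinear.Build k _ _ _ f fL.
pose aM := GRing.isMonoidMorphism.Build _ _ f fM.
pose fF : {lrmorphism ihopf k -> B} := HB.pack f aL aM.
by exists fF.
Qed.

Lemma galg_ofX (k : fieldType) (gT : finGroupType) (x : gT) n :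
  (galg_of k x : group_algebra k gT) ^+ n = galg_of k (x ^+ n)%g.
Proof.
elim: n => [|n IHn] //.
by rewrite exprS IHn expgS; apply: galg_ofM.
Qed.

Lemma closed_field_root_neg1 {k : fieldType} : GRing.closed_field_axiom k ->
  forall n, (0 < n)%N -> exists z : k, z ^+ n = -1.
Proof.
move=> closed [//|n] _.
(* The axiom solves z^m = \sum_(i < m) P_i z^i; here m = [n.+1] and only P_0 = - 1 is nonzero. *)
have [z zE] := closed n.+1 (fun i => if i == 0%N then -1 else 0) isT.
exists z; rewrite zE big_ord_recl /= mulr1 big1 ?addr0 // => i _.
by rewrite mul0r.
Qed.

Theorem proposition5p2 (k : fieldType) (hk : 2%N \notin [pchar k]) :
  commutative (@GRing.mul (ihopf k)) /\
  (GRing.closed_field_axiom k ->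
   exists f : {lrmorphism ihopf k -> group_algebra k 'Z_4}, bijective f).
Proof.
split=> [|closed]; first exact: ihopf_mulC.
have [z z4] := closed_field_root_neg1 closed 4 isT.
(* The group law of ['Z_4] is addition, so this ring unit is a generator and not the identity. *)
pose s : 'Z_4 := 1.
pose t : group_algebra k 'Z_4 := galg_of k s.
have aX n : (z *: t) ^+ n = z ^+ n *: (galg_of k (s ^+ n)%g : group_algebra k 'Z_4).
  by rewrite exprZn galg_ofX.
have a4 : (z *: t) ^+ 4 = -1.
  (* What remains, t^4 = 1, holds by computation in ['Z_4]. *)
  rewrite aX z4 scaleN1r; congr (- _).
have [f fE] := ihopf_lift (z *: t) a4.
(* The matrix of [f] is monomial; indices 1 and 2 are exchanged because g goes to z^2 t^2 and h to z
   t. *)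
have fEz x : [/\ (f x : {ffun _ -> _}) o0 = (x : 'rV_4) 0 o0,
    (f x : {ffun _ -> _}) o1 = z * (x : 'rV_4) 0 o2,
    (f x : {ffun _ -> _}) o2 = z ^+ 2 * (x : 'rV_4) 0 o1 &
    (f x : {ffun _ -> _}) o3 = - z ^+ 3 * (x : 'rV_4) 0 o3].
  rewrite fE sum4 /ihopf_powers /= !aX.
  by split; rewrite !ffunE /= /GRing.scale /=; ring.
(* z^-1 = - z^3 *)
pose g (u : group_algebra k 'Z_4) : ihopf k := \row_i
  match val i with
  | 0%N => (u : {ffun _ -> _}) o0
  | 1%N => - z ^+ 2 * (u : {ffun _ -> _}) o2
  | 2%N => - z ^+ 3 * (u : {ffun _ -> _}) o1
  | _ => z * (u : {ffun _ -> _}) o3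
  end.
exists f; exists g => [x|u].
  have [f0 f1 f2 f3] := fEz x.
  by apply/rowP; apply: ord4P; rewrite mxE /= ?(f0, f1, f2, f3); ring: z4.
have [f0 f1 f2 f3] := fEz (g u).
by apply/ffunP; apply: ord4P; rewrite ?(f0, f1, f2, f3) mxE /=; ring: z4.
Qed.
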